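(* Let $p$ and $q$ be CCS processes that both have free actions. Then $p\approx^c q$ if and only if $p+r\approx q+r$ for all CCS processes $r$.
   Context: Processes. Let $\alpha$ and $\beta$ be nonempty sets. Labels are $\mathrm{name}(b)$ and $\mathrm{coname}(b)$ for $b\in\beta$; the complement $\overline{\cdot}$ exchanges $\mathrm{name}(b)$ and $\mathrm{coname}(b)$. Actions are $\tau$ and the labels. CCS processes are the terms freely generated by: $\mathrm{nil}$; variables (constants) $X\in\alpha$; $u.E$ ($u$ an action); $E+E'$; $E\,||\,E'$; $\nu L\,E$ ($L$ a set of labels); $\mathrm{relab}(E,f)$ ($f$ a function from labels to labels commuting with complement, extended to actions by $f(\tau)=\tau$); $\mathrm{rec}\,X.E$. The transition relation $E\xrightarrow{u}E'$ is the least relation such that: $u.E\xrightarrow{u}E$; if $E\xrightarrow{u}E_1$ then $E+E'\xrightarrow{u}E_1$ and $E'+E\xrightarrow{u}E_1$; if $E\xrightarrow{u}E_1$ then $E||E'\xrightarrow{u}E_1||E'$ and $E'||E\xrightarrow{u}E'||E_1$; if $E\xrightarrow{l}E_1$ and $E'\xrightarrow{\overline{l}}E_2$ for a label $l$ then $E||E'\xrightarrow{\tau}E_1||E_2$; if $E\xrightarrow{u}E_1$ and either $u=\tau$ or $u$ is a label with $u,\overline{u}\notin L$, then $\nu L\,E\xrightarrow{u}\nu L\,E_1$; if $E\xrightarrow{u}E_1$ then $\mathrm{relab}(E,f)\xrightarrow{f(u)}\mathrm{relab}(E_1,f)$; if $E\{\mathrm{rec}\,X.E/X\}\xrightarrow{u}E_1$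 then $\mathrm{rec}\,X.E\xrightarrow{u}E_1$ (the substitution replaces the occurrences of $X$ not under a binder $\mathrm{rec}\,X$). Weak notions. $E\overset{\epsilon}{\Rightarrow}E'$ is the reflexive transitive closure of $\xrightarrow{\tau}$. For any action $u$ (including $\tau$), $E\overset{u}{\Rightarrow}E'$ means there are $E_1,E_2$ with $E\overset{\epsilon}{\Rightarrow}E_1\xrightarrow{u}E_2\overset{\epsilon}{\Rightarrow}E'$. A relation $W$ on processes is a weak bisimulation if whenever $W\,E\,E'$: for each label $l$, $E\xrightarrow{l}E_1$ implies there is $E_2$ with $E'\overset{l}{\Rightarrow}E_2$ and $W\,E_1\,E_2$, and $E'\xrightarrow{l}E_2$ implies there is $E_1$ with $E\overset{l}{\Rightarrow}E_1$ and $W\,E_1\,E_2$; and $E\xrightarrow{\tau}E_1$ implies there is $E_2$ with $E'\overset{\epsilon}{\Rightarrow}E_2$ and $W\,E_1\,E_2$, and $E'\xrightarrow{\tau}E_2$ implies there is $E_1$ with $E\overset{\epsilon}{\Rightarrow}E_1$ and $W\,E_1\,E_2$. Weak equivalence: $E\approx E'$ iff $W\,E\,E'$ for some weak bisimulation $W$. Observation congruence: $E\approx^c E'$ iff for every action $u$ (including $\tau$): for every $E_1$ with $E\xrightarrow{u}E_1$ there is $E_2$ with $E'\overset{u}{\Rightarrow}E_2$ and $E_1\approx E_2$; and for every $E_2$ with $E'\xrightarrow{u}E_2$ there is $E_1$ with $E\overset{u}{\Rightarrow}E_1$ and $E_1\approx E_2$. A process $p$ has free actions if there is a label $a$ such that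 there is no $p'$ with $p\overset{a}{\Rightarrow}p'$. *)

(* Defs.v *)
From Stdlib Require Import Relations Ensembles ClassicalEpsilon.

Set Implicit Arguments.
Unset Strict Implicit.
Unset Printing Implicit Defensive.

Inductive label (beta : Type) : Type :=
| Name (b : beta)
| Coname (b : beta).

Definition compl (beta : Type) (l : label beta) : label beta :=
  match l with
  | Name b => Coname b
  | Coname b => Name b
  end.

Inductive action (beta : Type) : Type :=
| Tau
| Lab (l : label beta).

Arguments Tau {beta}.

Record relabeling (beta : Type) : Type := Relabeling {
  relab_label :> label beta -> label beta;
  relab_compl : forall l, relab_label (compl l) = compl (relab_label l)
}.

Definition relab_action (beta : Type) (f : relabeling beta) (u : action beta) :
    action beta :=
  match u with
  | Tau => Tau
  | Lab l => Lab (f l)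
  end.

Inductive process (alpha beta : Type) : Type :=
| Nil
| Var (X : alpha)
| Prefix (u : action beta) (E : process alpha beta)
| Sum (E E' : process alpha beta)
| Par (E E' : process alpha beta)
| Restr (L : Ensemble (label beta)) (E : process alpha beta)
| Relab (E : process alpha beta) (f : relabeling beta)
| Rec (X : alpha) (E : process alpha beta).

Arguments Nil {alpha beta}.
Arguments Var {alpha beta} X.

(* [subst F X E] is E{F/X}.  Only the occurrences of X below a binder [Rec X]
   are protected; bound variables are not renamed, so free variables of F may
   be captured by the other binders of E.  Equality on [alpha] is decided
   classically. *)
Fixpoint subst (alpha beta : Type) (F : process alpha beta) (X : alpha)
    (E : process alpha beta) : process alpha beta :=
  match E with
  | Nil => Nil
  | Var Y => if excluded_middle_informative (Y = X) then F else Var Y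
  | Prefix u E1 => Prefix u (subst F X E1)
  | Sum E1 E2 => Sum (subst F X E1) (subst F X E2)
  | Par E1 E2 => Par (subst F X E1) (subst F X E2)
  | Restr L E1 => Restr L (subst F X E1)
  | Relab E1 f => Relab (subst F X E1) f
  | Rec Y E1 =>
      if excluded_middle_informative (Y = X) then Rec Y E1
      else Rec Y (subst F X E1)
  end.

Inductive trans (alpha beta : Type) :
    process alpha beta -> action beta -> process alpha beta -> Prop :=
| trans_prefix u E : trans (Prefix u E) u E
| trans_sum_l u E E1 E' : trans E u E1 -> trans (Sum E E') u E1
| trans_sum_r u E E1 E' : trans E u E1 -> trans (Sum E' E) u E1
| trans_par_l u E E1 E' : trans E u E1 -> trans (Par E E') u (Par E1 E')
| trans_par_r u E E1 E' : trans E u E1 -> trans (Par E' E) u (Par E' E1)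
| trans_par_sync l E E1 E' E2 :
    trans E (Lab l) E1 -> trans E' (Lab (compl l)) E2 ->
    trans (Par E E') Tau (Par E1 E2)
| trans_restr_tau L E E1 : trans E Tau E1 -> trans (Restr L E) Tau (Restr L E1)
| trans_restr_lab L l E E1 :
    trans E (Lab l) E1 -> ~ In _ L l -> ~ In _ L (compl l) ->
    trans (Restr L E) (Lab l) (Restr L E1)
| trans_relab f u E E1 :
    trans E u E1 -> trans (Relab E f) (relab_action f u) (Relab E1 f)
| trans_rec X u E E1 :
    trans (subst (Rec X E) X E) u E1 -> trans (Rec X E) u E1.

Definition eps (alpha beta : Type) : relation (process alpha beta) :=
  clos_refl_trans _ (fun E E' => trans E Tau E').

(* For [u = Tau] at least one tau transition is required, unlike in [eps]. *)
Definition weak_trans (alpha beta : Type) (E : process alpha beta)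
    (u : action beta) (E' : process alpha beta) : Prop :=
  exists E1 E2, eps E E1 /\ trans E1 u E2 /\ eps E2 E'.

Definition weak_bisimulation (alpha beta : Type)
    (W : relation (process alpha beta)) : Prop :=
  forall E E', W E E' ->
    (forall l : label beta,
      (forall E1, trans E (Lab l) E1 ->
        exists E2, weak_trans E' (Lab l) E2 /\ W E1 E2) /\
      (forall E2, trans E' (Lab l) E2 ->
        exists E1, weak_trans E (Lab l) E1 /\ W E1 E2)) /\
    (forall E1, trans E Tau E1 -> exists E2, eps E' E2 /\ W E1 E2) /\
    (forall E2, trans E' Tau E2 -> exists E1, eps E E1 /\ W E1 E2).

Definition weak_equiv (alpha beta : Type) : relation (process alpha beta) :=
  fun E E' => exists W, weak_bisimulation W /\ W E E'.

Definition obs_congr (alpha beta : Type) : relation (process alpha beta) :=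
  fun E E' => forall u : action beta,
    (forall E1, trans E u E1 ->
      exists E2, weak_trans E' u E2 /\ weak_equiv E1 E2) /\
    (forall E2, trans E' u E2 ->
      exists E1, weak_trans E u E1 /\ weak_equiv E1 E2).

Definition has_free_actions (alpha beta : Type) (p : process alpha beta) : Prop :=
  exists a : label beta, ~ exists p', weak_trans p (Lab a) p'.

(* Main.v *)
(** For the converse implication, test [p + r ≈ q + r] with [r := a.nil], where
    [a] is a free action of [p].  A move [p -u-> p1] must be answered by
    [q + a.nil].  The summand [a.nil] cannot contribute to the answer, since then
    [u = a] and [p] could do [a]; nor can the answer to a tau be to stay idle,
    since then [p1 ≈ q + a.nil] and [p] could do a tau followed by [a].  So [q]
    itself answers, and by at least one step.  Moves of [q] are treated
    symmetrically, with a free action of [q]. *)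

From Stdlib Require Import Relations.
Require Import Defs.

Set Implicit Arguments.
Unset Strict Implicit.
Unset Printing Implicit Defensive.

Section WeakEquivalence.

Variables alpha beta : Type.
Implicit Types (E F G p q r : process alpha beta) (u v : action beta).

Lemma eps_cases E G :
  eps E G -> E = G \/ exists F, trans E Tau F /\ eps F G.
Proof.
  intros H; apply clos_rt_rt1n in H; destruct H as [|F G HEF HFG].
  - now left.
  - right; exists F; split; [exact HEF | now apply clos_rt1n_rt].
Qed.

Lemma weak_trans_step E u G : trans E u G -> weak_trans E u G.
Proof.
  intros H; exists E, G; split; [apply rt_refl | split; [exact H | apply rt_refl]].
Qed.

Lemma weak_trans_tau_cons E F u G :
  trans E Tau F -> weak_trans F u G -> weak_trans E u G.
Proof.
  intros H (E1 & E2 & H1 & H2 & H3); exists E1, E2; repeat split; trivial.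
  apply rt_trans with F; [now apply rt_step | exact H1].
Qed.

(** Isolating the first transition reduces weak moves of [Sum] and [Prefix] to inversion of a single
    transition: that transition leaves the operator behind, and the rest concerns [F] alone. *)
Lemma weak_trans_cases E u G :
  weak_trans E u G ->
  exists v F, trans E v F /\ (v = u /\ eps F G \/ v = Tau /\ weak_trans F u G).
Proof.
  intros (E1 & E2 & H1 & H2 & H3).
  destruct (eps_cases H1) as [<- | (F & HF & HF1)].
  - exists u, E2; auto.
  - exists Tau, F; split; [exact HF | right; split; [reflexivity|]].
    now exists E1, E2.
Qed.

Lemma weak_trans_of_cases E v F u G :
  trans E v F -> v = u /\ eps F G \/ v = Tau /\ weak_trans F u G ->
  weak_trans E u G.
Proof.
  intros H [[-> HG] | [-> HG]].
  - exists E, F; split; [apply rt_refl | now split].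
  - now apply weak_trans_tau_cons with F.
Qed.

Lemma weak_trans_tau_eps E G : weak_trans E Tau G -> eps E G.
Proof.
  intros (E1 & E2 & H1 & H2 & H3).
  apply rt_trans with E1; [exact H1|].
  apply rt_trans with E2; [now apply rt_step | exact H3].
Qed.

Lemma eps_weak_trans_tau E G : eps E G -> E = G \/ weak_trans E Tau G.
Proof.
  intros H; destruct (eps_cases H) as [-> | (F & HF & HG)]; [now left | right].
  now apply weak_trans_of_cases with Tau F; [|left].
Qed.

Lemma trans_sum_inv E F u G : trans (Sum E F) u G -> trans E u G \/ trans F u G.
Proof. inversion 1; auto. Qed.

(** The first transition resolves the choice. The analogue for [eps] breaks down in the idle case,
    where the summand [F] remains. *)
Lemma weak_trans_sum_l E F u G : weak_trans E u G -> weak_trans (Sum E F) u G.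
Proof.
  intros H; destruct (weak_trans_cases H) as (v & E1 & H1 & HG).
  apply weak_trans_of_cases with v E1; [now apply trans_sum_l | exact HG].
Qed.

Lemma weak_trans_sum_inv E F u G :
  weak_trans (Sum E F) u G -> weak_trans E u G \/ weak_trans F u G.
Proof.
  intros H; destruct (weak_trans_cases H) as (v & E1 & H1 & HG).
  destruct (trans_sum_inv H1); [left | right];
    now apply weak_trans_of_cases with v E1.
Qed.

Lemma weak_trans_prefix_lab_inv (a : label beta) E u G :
  weak_trans (Prefix (Lab a) E) u G -> u = Lab a \/ weak_trans E u G.
Proof.
  intros H; destruct (weak_trans_cases H) as (v & F & H1 & HG).
  inversion H1; subst.
  destruct HG as [[<- _] | [Hv _]]; [now left | discriminate].
Qed.

Lemma weak_trans_nil_inv u G : ~ weak_trans (@Nil alpha beta) u G.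
Proof.
  intros H; destruct (weak_trans_cases H) as (v & F & H1 & _); inversion H1.
Qed.

Lemma weak_equiv_bisimulation : weak_bisimulation (@weak_equiv alpha beta).
Proof.
  intros E F (W & HW & HEF).
  destruct (HW _ _ HEF) as (Hl & Ht1 & Ht2).
  split; [intros l; destruct (Hl l) as [Hl1 Hl2]; split | split].
  - intros E1 H; destruct (Hl1 _ H) as (F1 & HF & HW1).
    exists F1; split; [exact HF | now exists W].
  - intros F1 H; destruct (Hl2 _ H) as (E1 & HE & HW1).
    exists E1; split; [exact HE | now exists W].
  - intros E1 H; destruct (Ht1 _ H) as (F1 & HF & HW1).
    exists F1; split; [exact HF | now exists W].
  - intros F1 H; destruct (Ht2 _ H) as (E1 & HE & HW1).
    exists E1; split; [exact HE | now exists W].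
Qed.

Lemma weak_equiv_refl E : weak_equiv E E.
Proof.
  exists eq; split; [|reflexivity].
  intros F ? <-; split; [intros l; split | split]; intros G H; exists G;
    split; auto using weak_trans_step.
  - now apply rt_step.
  - now apply rt_step.
Qed.

Lemma weak_equiv_sym E F : weak_equiv E F -> weak_equiv F E.
Proof.
  intros (W & HW & HEF); exists (fun G H => W H G); split; [|exact HEF].
  intros G H HGH; destruct (HW _ _ HGH) as (Hl & Ht1 & Ht2).
  split; [intros l; destruct (Hl l); now split | now split].
Qed.

Lemma obs_congr_sym p q : obs_congr p q -> obs_congr q p.
Proof.
  intros H u; destruct (H u) as [H1 H2].
  split; [intros q1 Hq; destruct (H2 _ Hq) as (p1 & Hp & He)
         |intros p1 Hp; destruct (H1 _ Hp) as (q1 & Hq & He)];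
    eauto using weak_equiv_sym.
Qed.

Lemma obs_congr_weak_equiv p q : obs_congr p q -> weak_equiv p q.
Proof.
  (* After one move only weak equivalence is guaranteed, so [weak_equiv] is joined to [obs_congr] to
     make the relation closed under transitions. *)
  intros Hpq; exists (fun E F => obs_congr E F \/ weak_equiv E F).
  split; [clear p q Hpq | now left].
  intros E F [H | H].
  - split; [intros l; destruct (H (Lab l)) as [H1 H2]; split
           | destruct (H Tau) as [H1 H2]; split].
    + intros E1 HE; destruct (H1 _ HE) as (F1 & HF & He); eauto.
    + intros F1 HF; destruct (H2 _ HF) as (E1 & HE & He); eauto.
    + intros E1 HE; destruct (H1 _ HE) as (F1 & HF & He);
        eauto using weak_trans_tau_eps.
    + intros F1 HF; destruct (H2 _ HF) as (E1 & HE & He);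
        eauto using weak_trans_tau_eps.
  - destruct (weak_equiv_bisimulation H) as (Hl & Ht1 & Ht2).
    split; [intros l; destruct (Hl l) as [Hl1 Hl2]; split | split].
    + intros E1 HE; destruct (Hl1 _ HE) as (F1 & HF & He); eauto.
    + intros F1 HF; destruct (Hl2 _ HF) as (E1 & HE & He); eauto.
    + intros E1 HE; destruct (Ht1 _ HE) as (F1 & HF & He); eauto.
    + intros F1 HF; destruct (Ht2 _ HF) as (E1 & HE & He); eauto.
Qed.

(** A move of [p] is answered by [q] with at least one transition, which survives in the sum even
    for [Tau]; a move of [r] is answered by itself. *)
Lemma obs_congr_trans_sum p q r u G :
  obs_congr p q -> trans (Sum p r) u G ->
  exists G', weak_trans (Sum q r) u G' /\ weak_equiv G G'.
Proof.
  intros Hpq H; destruct (trans_sum_inv H) as [Hp | Hr].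
  - destruct (proj1 (Hpq u) _ Hp) as (q1 & Hq & He).
    exists q1; split; [now apply weak_trans_sum_l | exact He].
  - exists G; split; [| apply weak_equiv_refl].
    now apply weak_trans_step, trans_sum_r.
Qed.

Lemma obs_congr_sum p q r : obs_congr p q -> obs_congr (Sum p r) (Sum q r).
Proof.
  intros Hpq u; split.
  - intros G H; exact (obs_congr_trans_sum Hpq H).
  - intros G H.
    destruct (obs_congr_trans_sum (obs_congr_sym Hpq) H) as (G' & HG & He).
    eauto using weak_equiv_sym.
Qed.

(** One direction of the game for [obs_congr]; the other follows by exchanging [p] and [q] and using
    a free action of [q]. *)
Lemma free_action_transfer (a : label beta) p q u p1 :
  ~ (exists p', weak_trans p (Lab a) p') ->
  weak_equiv (Sum p (Prefix (Lab a) Nil)) (Sum q (Prefix (Lab a) Nil)) ->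
  trans p u p1 -> exists q1, weak_trans q u q1 /\ weak_equiv p1 q1.
Proof.
  intros Hfree Heq Hp.
  (* An answer from the test summand would force [u = Lab a], and then [Hp] itself contradicts
     [Hfree]. *)
  assert (Hsum : forall G, weak_trans (Sum q (Prefix (Lab a) Nil)) u G ->
                   weak_trans q u G).
  { intros G HG; destruct (weak_trans_sum_inv HG) as [HG1 | HG1]; [exact HG1|].
    destruct (weak_trans_prefix_lab_inv HG1) as [-> | HG2].
    - case Hfree; exists p1; now apply weak_trans_step.
    - now apply weak_trans_nil_inv in HG2. }
  destruct (weak_equiv_bisimulation Heq) as (Hl & Ht & _).
  destruct u as [|l].
  - destruct (Ht p1 (trans_sum_l _ Hp)) as (q1 & Hq & He).
    destruct (eps_weak_trans_tau Hq) as [<- | Hq1]; [|eauto].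
    (* Idle answer: [p1] is equivalent to the whole sum, so it must match the [a]-transition of the
       test summand, giving [p] a weak [a]-transition after its tau. *)
    destruct (weak_equiv_bisimulation He) as (Hl1 & _).
    destruct (proj2 (Hl1 a) Nil) as (p2 & Hp2 & _).
    { apply trans_sum_r, trans_prefix. }
    case Hfree; exists p2; now apply weak_trans_tau_cons with p1.
  - destruct (proj1 (Hl l) p1 (trans_sum_l _ Hp)) as (q1 & Hq & He); eauto.
Qed.

End WeakEquivalence.

Theorem theorem14 (alpha beta : Type) (halpha : inhabited alpha)
    (hbeta : inhabited beta) (p q : process alpha beta)
    (hp : has_free_actions p) (hq : has_free_actions q) :
  obs_congr p q <-> (forall r : process alpha beta, weak_equiv (Sum p r) (Sum q r)).
Proof.
  split.
  - intros H r; now apply obs_congr_weak_equiv, obs_congr_sum.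
  - destruct hp as [a Ha], hq as [b Hb].
    intros H u; split.
    + intros p1 Hp; exact (free_action_transfer Ha (H _) Hp).
    + intros q1 Hq.
      destruct (free_action_transfer Hb (weak_equiv_sym (H _)) Hq)
        as (p1 & Hp & He).
      eauto using weak_equiv_sym.
Qed.
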